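(* Let $U$ be a unitary operator on a separable Hilbert space $H$, let $\mathbf B:\mathbb C^d\to H$ be an isometry such that $\operatorname{Ran}\mathbf B$ is a star-cyclic subspace for $U$, and let $\Gamma$ be a strict contraction on $\mathbb C^d$. Then the operator $T=U+\mathbf B(\Gamma-\mathbf I_{\mathbb C^d})\mathbf B^*U$ is a completely non-unitary contraction.
   Context: A subspace $\mathfrak R\subset H$ is star-cyclic for an operator $A$ on $H$ if $H=\overline{\operatorname{span}}\{A^k\mathfrak R,(A^* )^k\mathfrak R:k\ge0\}$. A contraction $\Gamma$ is called strict if $\|\Gamma x\|<\|x\|$ for all $x\ne0$. A contraction is completely non-unitary if there is no non-zero reducing subspace on which it acts unitarily. *)

(* Defs.v *)
From mathcomp Require Import all_boot all_order all_algebra.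
From mathcomp Require Import sesquilinear spectral.
From mathcomp Require Import all_classical all_reals topology normedtype.
From mathcomp Require Import complex.

Set Implicit Arguments.
Unset Strict Implicit.
Unset Printing Implicit Defensive.

Import Order.TTheory GRing.Theory Num.Theory.

Local Open Scope classical_set_scope.
Local Open Scope ring_scope.

Definition separable_space (X : topologicalType) : Prop :=
  exists2 S : set X, countable S & dense S.

Section InnerProduct.
Variables (C : numClosedFieldType) (V W : lmodType C).
Variables (dotV : {dot V for Num.conj}) (dotW : {dot W for Num.conj}).

Definition dnorm (v : V) : C := sqrtC (dotV v v).

(* The adjoint is unique when it exists, which is the case for every bounded
   operator between Hilbert spaces; 0 is a default value otherwise. *)
Definition adjoint (f : {linear V -> W}) : {linear W -> V} :=
  if pselect (exists g : {linear W -> V},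
                forall v w, dotW (f v) w = dotV v (g w)) is left h
  then projT1 (cid h) else \0.

End InnerProduct.

Section Operators.
Variables (C : numClosedFieldType) (V : lmodType C).
Variable dot : {dot V for Num.conj}.
Implicit Types (A : {linear V -> V}) (E : set V).

Definition contraction_op A : Prop := forall x, dnorm dot (A x) <= dnorm dot x.

Definition strict_contraction A : Prop :=
  contraction_op A /\ forall x, x != 0 -> dnorm dot (A x) < dnorm dot x.

(* A maps E isometrically onto itself. *)
Definition unitary_on E A : Prop :=
  A @` E = E /\ forall x y, E x -> E y -> dot (A x) (A y) = dot x y.

Definition unitary A : Prop := unitary_on setT A.

Definition linear_span E : set V :=
  [set x | exists n (c : 'I_n -> C) (v : 'I_n -> V),
     (forall i, E (v i)) /\ x = \sum_(i < n) c i *: v i].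

End Operators.

Section Hilbert.
Variables (C : numClosedFieldType) (H : normedModType C).
Variable dot : {dot H for Num.conj}.
Implicit Types (A : {linear H -> H}) (E : set H).

Definition norm_induced_by_dot : Prop := forall x : H, `|x| = dnorm dot x.

Definition closed_subspace E : Prop :=
  [/\ closed E, E 0 & forall (a : C) x y, E x -> E y -> E (a *: x + y)].

Definition star_cyclic A E : Prop :=
  closure (linear_span
    (\bigcup_k (iter k A @` E `|` iter k (adjoint dot dot A) @` E))) = setT.

Definition reducing A E : Prop :=
  [/\ closed_subspace E, A @` E `<=` E & adjoint dot dot A @` E `<=` E].

Definition completely_non_unitary A : Prop :=
  forall E, reducing A E -> unitary_on dot E A -> E = [set 0].

End Hilbert.

(* Main.v *)
Require Import Defs.
From HB Require Import structures.
From mathcomp Require Import all_boot all_order all_algebra.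
From mathcomp Require Import sesquilinear spectral.
From mathcomp Require Import all_classical all_reals topology normedtype.
From mathcomp Require Import complex.

(** Write [b = B^* U x]. Then [T x = U x + B (Gamma b - b)] replaces the
    component [B b] of [U x] along the range of [B] by [B (Gamma b)] and leaves
    the orthogonal component alone, so Pythagoras ([dot_perturb]) gives
      [|T x|^2 = |x|^2 - (|b|^2 - |Gamma b|^2)],
    and [T] is a contraction because [Gamma] is one.

    Suppose that [T] acts unitarily on a reducing subspace [E]. For [x] in [E]
    the identity forces [|Gamma b| = |b|], hence [b = 0] by strictness, and so
    [T x = U x]. Therefore [U E = T E = E]. Every element of [E] is thus some
    [U x] with [x] in [E], for which [B^* U x = 0]: the space [E] is orthogonal
    to the range of [B]. As [U] maps [E] onto itself, [E] stays orthogonal to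
    the images of that range under all powers of [U] and [U^*]
    ([orthogonal_orbits]). Star-cyclicity says that these images span a dense
    subspace, and a vector orthogonal to a dense set vanishes
    ([orthogonal_closure0]). *)

Local Open Scope classical_set_scope.
Local Open Scope ring_scope.

Set Implicit Arguments.
Unset Strict Implicit.
Unset Printing Implicit Defensive.

Import Order.TTheory GRing.Theory Num.Theory.

Section Adjoint.
Variables (C : numClosedFieldType) (V W : lmodType C).
Variables (dotV : {dot V for Num.conj}) (dotW : {dot W for Num.conj}).

Lemma dot_injr (x y : V) : (forall v, dotV v x = dotV v y) -> x = y.
Proof.
move=> exy; apply/eqP; rewrite -subr_eq0 -(dnorm_eq0 dotV).
by rewrite linearBr/= exy subrr.
Qed.

Lemma dotC0 (x y : V) : dotV x y = 0 -> dotV y x = 0.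
Proof. by move=> /eqP xy0; apply/eqP; rewrite herm_eq0C. Qed.

(** It is enough to produce the values of the adjoint one at a time: they are
    unique because the form is definite, and uniqueness makes the resulting
    function linear. *)
Lemma adjointE (f : {linear V -> W}) :
  (forall w, exists u, forall v, dotW (f v) w = dotV v u) ->
  forall v w, dotW (f v) w = dotV v (adjoint dotV dotW f w).
Proof.
move=> fP; pose g w := projT1 (cid (fP w)).
have gE v w : dotW (f v) w = dotV v (g w) by exact: (projT2 (cid (fP w))).
have g_lin : linear g.
  move=> a u w; apply: dot_injr => v.
  by rewrite -gE !linearPr /= -!gE.
pose gm := GRing.isLinear.Build _ _ _ _ g g_lin.
pose gl : {linear W -> V} := HB.pack g gm.
rewrite /adjoint; case: pselect => [h|[]]; first exact: (projT2 (cid h)).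
by exists gl.
Qed.

Lemma dnorm_le (x : V) (y : W) :
  (dnorm dotV x <= dnorm dotW y) = (dotV x x <= dotW y y).
Proof. by rewrite ler_sqrtC// nnegrE dnorm_ge0. Qed.

Lemma dnorm_lt (x : V) (y : W) :
  (dnorm dotV x < dnorm dotW y) = (dotV x x < dotW y y).
Proof. by rewrite ltr_sqrtC// nnegrE dnorm_ge0. Qed.

(** When [g] is the adjoint of the isometry [f], both sides have the same cross
    term, because [dotW y (f e) = dotV (g y) e]. This is the Pythagorean
    identity in a form that avoids the projection [f \o g]. *)
Lemma dot_perturb (f : {linear V -> W}) (g : W -> V) (y : W) (e : V) :
  (forall v w, dotW (f v) w = dotV v (g w)) ->
  isometry dotW dotV f ->
  dotW (y + f e) (y + f e) + dotV (g y) (g y) =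
  dotW y y + dotV (g y + e) (g y + e).
Proof.
move=> gE fiso; rewrite !dnormD fiso.
have -> : dotW y (f e) = dotV (g y) e.
  by rewrite hermC [RHS]hermC /= gE.
by rewrite (AC (2*1*1) (1*(4*2*3))).
Qed.

End Adjoint.

(** An operator defined on a finite-dimensional space has an adjoint, whose
    coordinates are read off on the standard basis. *)
Lemma adjoint_rVE (C : numClosedFieldType) (n : nat) (W : lmodType C)
    (dotW : {dot W for Num.conj}) (f : {linear 'rV[C]_n -> W}) v w :
  dotW (f v) w = dotmx v (adjoint (@dotmx C n) dotW f w).
Proof.
apply: adjointE => {v}z.
exists (\row_i (dotW (f (delta_mx 0 i)) z)^*) => v.
rewrite [in LHS](row_sum_delta v) linear_sum linear_sumlz /= dotmxE mxE.
apply: eq_bigr => i _.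
by rewrite linearZ linearZl_LR !mxE conjCK.
Qed.

(** The adjoint exists here because any preimage of [w] under [U] can serve as
    its value at [w]. *)
Lemma unitary_adjointE (C : numClosedFieldType) (V : lmodType C)
    (dot : {dot V for Num.conj}) (U : {linear V -> V}) v w :
  unitary dot U -> dot (U v) w = dot v (adjoint dot dot U w).
Proof.
move=> [Usurj Uiso]; apply: adjointE => {v}z.
have [u _ <-] : (U @` setT) z by rewrite Usurj.
by exists u => v; rewrite Uiso.
Qed.

(** Pythagoras bounds [|x - s|] below by [|x|] for every [s] orthogonal to [x],
    so a nonzero [x] cannot be approximated from [S]. *)
Lemma orthogonal_closure0 (C : numClosedFieldType) (H : normedModType C)
    (dot : {dot H for Num.conj}) (S : set H) (x : H) :
  norm_induced_by_dot dot -> closure S x -> (forall s, S s -> dot x s = 0) ->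
  x = 0.
Proof.
move=> normE Sx xS; apply/eqP/negP => /negP x0.
have /Sx [s [Ss]] : nbhs x (ball x `|x|).
  by apply: nbhsx_ballx; rewrite normr_gt0.
rewrite -ball_normE /= !normE dnorm_lt (hnormBd (xS s Ss)).
by rewrite gtrDl le_gtF ?dnorm_ge0.
Qed.

Lemma orthogonal_span (C : numClosedFieldType) (V : lmodType C)
    (dot : {dot V for Num.conj}) (E : set V) (x : V) :
  (forall e, E e -> dot x e = 0) -> forall s, linear_span E s -> dot x s = 0.
Proof.
move=> xE s [n [c [v [Ev ->]]]]; rewrite linear_sumr big1// => i _.
by rewrite linearZr_LR /= xE// mulr0.
Qed.

(** Each power is moved to the other side of the form: [U^*] becomes [U], which
    preserves [E], and [U] cancels against a preimage of [x], which lies in [E]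
    because [U] maps [E] onto [E]. *)
Lemma orthogonal_orbits (C : numClosedFieldType) (V : lmodType C)
    (dot : {dot V for Num.conj}) (U : {linear V -> V}) (E F : set V) :
  unitary dot U -> U @` E = E ->
  (forall x y, E x -> F y -> dot x y = 0) ->
  forall x s, E x ->
    (\bigcup_k (iter k U @` F `|` iter k (adjoint dot dot U) @` F)) s ->
    dot x s = 0.
Proof.
move=> Uunit UE EF x s Ex [k _ [[y Fy <-]|[y Fy <-]]].
- elim: k x Ex => [|k IHk] x Ex; first exact: EF.
  have [z Ez <-] : (U @` E) x by rewrite UE.
  by rewrite iterS (Uunit.2 _ _ I I) IHk.
- elim: k x Ex => [|k IHk] x Ex; first exact: EF.
  by rewrite iterS -unitary_adjointE// IHk// -UE; exists x.
Qed.

Theorem lemma1p4 (R : realType) (H : completeNormedModType R[i])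
    (dot : {dot H for Num.conj}) (d : nat)
    (U : {linear H -> H}) (B : {linear 'rV[R[i]]_d -> H})
    (Gamma : {linear 'rV[R[i]]_d -> 'rV[R[i]]_d}) :
  norm_induced_by_dot dot ->
  separable_space H ->
  unitary dot U ->
  isometry dot (@dotmx R[i] d) B ->
  star_cyclic dot U (range B) ->
  strict_contraction (@dotmx R[i] d) Gamma ->
  let T : {linear H -> H} :=
    U \+ (B \o (Gamma \- idfun) \o adjoint (@dotmx R[i] d) dot B \o U) in
  contraction_op dot T /\ completely_non_unitary dot T.
Proof.
move=> normE _ Uunit Biso cyc [Gle Glt] T.
pose b x := adjoint (@dotmx R[i] d) dot B (U x).
have TE x : T x = U x + B (Gamma (b x) - b x) by [].
(* The subtracted terms are moved across so that only sums occur. *)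
have defect x : dot (T x) (T x) + dotmx (b x) (b x) =
    dot x x + dotmx (Gamma (b x)) (Gamma (b x)).
  rewrite TE (dot_perturb _ _ (adjoint_rVE dot B) Biso) -/(b x).
  by rewrite (Uunit.2 _ _ I I) subrKC.
split.
  move=> x; rewrite dnorm_le -(lerD2r (dotmx (b x) (b x))) defect lerD2l.
  by rewrite -(dnorm_le (@dotmx _ d) (@dotmx _ d)) Gle.
move=> E [[_ E0 _] _ _] [TEE Tiso].
have b0 x : E x -> b x = 0.
  move=> Ex; apply/eqP/negPn/negP => /Glt; rewrite dnorm_lt /=.
  by have := defect x; rewrite Tiso// => /addrI ->; rewrite ltxx.
have TU x : E x -> T x = U x.
  by move=> Ex; rewrite TE b0// linear0 subrr linear0 addr0.
have UE : U @` E = E.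
  by rewrite -[RHS]TEE; apply: eq_imagel => x Ex; rewrite TU.
(* Write the vector of [E] as [U z]: its image under [B^*] is then [b z]. *)
have EB x y : E x -> range B y -> dot x y = 0.
  rewrite -{1}UE => -[z Ez <-] [c _ <-]; apply: dotC0.
  by rewrite adjoint_rVE -/(b z) b0// linear0r.
apply/seteqP; split => [x Ex|_ ->//].
have clx : [set: H] x by [].
rewrite -cyc in clx; apply: (orthogonal_closure0 normE clx).
by apply: orthogonal_span => s; apply: (orthogonal_orbits Uunit UE EB Ex).
Qed.
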